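(* Let $\mathbb{X}$ be a real reflexive Banach space and let $\mathbb{Y}$ be any real normed space. Let $T \in K(\mathbb{X},\mathbb{Y})$ be such that $M_T = D \cup (-D)$, where $D$ is a non-empty compact connected subset of $S_{\mathbb{X}}$. Then for any $A \in K(\mathbb{X},\mathbb{Y})$, $T \perp_B A$ if and only if there exists $x \in M_T$ such that $Tx \perp_B Ax$.
   Context: $S_{\mathbb{X}} = \{x \in \mathbb{X} : \|x\| = 1\}$ is the unit sphere of $\mathbb{X}$ (with the norm topology). $K(\mathbb{X},\mathbb{Y})$ is the normed space of compact linear operators from $\mathbb{X}$ to $\mathbb{Y}$ with the operator norm. For a bounded linear operator $T$, $M_T = \{x \in S_{\mathbb{X}} : \|Tx\| = \|T\|\}$. Birkhoff-James orthogonality: for elements $u,v$ of a real normed space, $u \perp_B v$ means $\|u\| \le \|u + \lambda v\|$ for all $\lambda \in \mathbb{R}$; for operators it is taken with respect to the operator norm, i.e. $T \perp_B A$ means $\|T\| \le \|T + \lambda A\|$ for all $\lambda \in \mathbb{R}$. *)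

(* Defs.v *)
From HB Require Import structures.
From mathcomp Require Import all_boot all_order all_algebra.
From mathcomp Require Import all_classical all_reals all_analysis.

Set Implicit Arguments.
Unset Strict Implicit.
Unset Printing Implicit Defensive.

Import Order.TTheory GRing.Theory Num.Theory.
Import numFieldNormedType.Exports.

Local Open Scope classical_set_scope.
Local Open Scope ring_scope.

Section bounded_operators.
Context {R : realType} (X Y : normedModType R).

Definition bounded_linear : {pred X -> Y} :=
  [pred f | `[< linear f /\ exists M : R, forall x, `|f x| <= M * `|x| >]].

Lemma bounded_linear_submod_closed : submod_closed bounded_linear.
Proof.
split=> [|a f g /asboolP[lf [M fM]] /asboolP[lg [N gN]]]; apply/asboolP.
  split=> [k u v|]; first by rewrite /= scaler0 addr0.
  by exists 0 => x; rewrite normr0 mul0r.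
split=> [k u v|].
  have E w : (a *: f + g) w = a *: f w + g w by [].
  rewrite !E lf lg.
  rewrite !scalerDr !scalerA [k * a]mulrC.
  by rewrite addrACA.
exists (`|a| * M + N) => x; rewrite (le_trans (ler_normD (a *: f x) (g x)))//.
by rewrite mulrDl lerD// normrZ -mulrA ler_wpM2l.
Qed.

HB.instance Definition _ :=
  GRing.isSubmodClosed.Build _ _ bounded_linear bounded_linear_submod_closed.

Record boundedOp := BoundedOp {
  boundedOp_fun :> X -> Y ;
  boundedOpP : boundedOp_fun \in bounded_linear }.

HB.instance Definition _ := [isSub for boundedOp_fun].
HB.instance Definition _ := [Choice of boundedOp by <:].
HB.instance Definition _ := [SubChoice_isSubLmodule of boundedOp by <:].

Lemma boundedOp_linear (f : boundedOp) : linear f.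
Proof. by have /asboolP[] := boundedOpP f. Qed.

HB.instance Definition _ (f : boundedOp) :=
  GRing.isLinear.Build R X Y _ f (@boundedOp_linear f).

Definition opnorm (f : boundedOp) : R :=
  sup [set `|f x| | x in [set x : X | `|x| <= 1]].

Lemma opnorm_has_sup (f : boundedOp) :
  has_sup [set `|f x| | x in [set x : X | `|x| <= 1]].
Proof.
split; first by exists `|f 0|; exists 0 => //=; rewrite normr0.
have /asboolP[_ [M fM]] := boundedOpP f.
exists `|M| => _ [x /= x1 <-]; apply: (le_trans (fM x)).
apply: (@le_trans _ _ (`|M| * `|x|)); first by rewrite ler_wpM2r// ler_norm.
by rewrite -[leRHS]mulr1 ler_wpM2l.
Qed.

Lemma le_opnorm (f : boundedOp) x : `|f x| <= opnorm f * `|x|.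
Proof.
have [->|x0] := eqVneq x 0; first by rewrite linear0 !normr0 mulr0.
have nx0 : 0 < `|x| by rewrite normr_gt0.
rewrite -ler_pdivrMr// -[leLHS](_ : `|f (`|x|^-1 *: x)| = _); last first.
  by rewrite linearZ normrZ gtr0_norm ?invr_gt0// mulrC.
apply: ub_le_sup; first by have [] := opnorm_has_sup f.
exists (`|x|^-1 *: x) => //=.
by rewrite normrZ gtr0_norm ?invr_gt0// mulVf ?gt_eqF.
Qed.

Lemma opnorm_le (f : boundedOp) M :
  (forall x, `|x| <= 1 -> `|f x| <= M) -> opnorm f <= M.
Proof.
move=> fM; apply: ge_sup; first by have [] := opnorm_has_sup f.
by move=> _ [x /= x1 <-]; exact: fM.
Qed.

Lemma opnorm_ge0 (f : boundedOp) : 0 <= opnorm f.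
Proof.
apply: (le_trans (normr_ge0 (f 0))); apply: ub_le_sup.
  by have [] := opnorm_has_sup f.
by exists 0 => //=; rewrite normr0.
Qed.

Lemma ler_opnormD (f g : boundedOp) : opnorm (f + g) <= opnorm f + opnorm g.
Proof.
apply: opnorm_le => x x1; rewrite (le_trans (ler_normD (f x) (g x)))// lerD//.
  by rewrite (le_trans (le_opnorm f x))// ler_piMr// opnorm_ge0.
by rewrite (le_trans (le_opnorm g x))// ler_piMr// opnorm_ge0.
Qed.

Let opnormZ_le (a : R) (f : boundedOp) : opnorm (a *: f) <= `|a| * opnorm f.
Proof.
apply: opnorm_le => x x1; rewrite [leLHS](normrZ a (f x)) ler_wpM2l//.
by rewrite (le_trans (le_opnorm f x))// ler_piMr// opnorm_ge0.
Qed.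

Lemma opnormZ (a : R) (f : boundedOp) : opnorm (a *: f) = `|a| * opnorm f.
Proof.
apply/eqP; rewrite eq_le opnormZ_le/=.
have [->|a0] := eqVneq a 0; first by rewrite normr0 mul0r opnorm_ge0.
rewrite -ler_pdivlMl ?normr_gt0// -normfV.
by rewrite -[in leLHS](scalerK a0 f) opnormZ_le.
Qed.

Lemma opnorm0_eq0 (f : boundedOp) : opnorm f = 0 -> f = 0.
Proof.
move=> f0; apply/val_inj/funext => x; apply/normr0_eq0/eqP.
by rewrite eq_le normr_ge0 andbT (le_trans (le_opnorm f x))// f0 mul0r.
Qed.

HB.instance Definition _ :=
  Lmodule_isNormed.Build R boundedOp ler_opnormD opnormZ opnorm0_eq0.

Lemma boundedOp_normE (f : boundedOp) : `|f| = opnorm f.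
Proof. by []. Qed.

(* The library's [precompact] means relatively compact: [precompact B] is
   [compact (closure B)] (lemma [precompactE]), the closure being taken in Y
   itself even when Y is not complete.  Requiring [f] to be bounded beforehand
   loses nothing: a linear map sending the unit ball into a compact set is
   bounded. *)
Definition compact_operator (f : boundedOp) : Prop :=
  precompact (f @` [set x : X | `|x| <= 1]).

End bounded_operators.

Definition unit_sphere {R : realType} (X : normedModType R) : set X :=
  [set x | `|x| = 1].
Arguments unit_sphere {R} X.

Definition norm_attaining_set {R : realType} {X Y : normedModType R}
    (f : boundedOp X Y) : set X :=
  [set x | unit_sphere X x /\ `|f x| = `|f|].

Definition birkhoff_james {R : realType} {V : normedModType R} (u v : V) : Prop :=
  forall a : R, `|u| <= `|u + a *: v|.

Definition dual {R : realType} (X : normedModType R) : normedModType R :=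
  boundedOp X R^o.

Section reflexivity.
Context {R : realType} (X : normedModType R).

Definition evaluation (x : X) : dual X -> R^o := fun f => f x.

Lemma evaluation_bounded_linear x : evaluation x \in @bounded_linear R (dual X) R^o.
Proof.
apply/asboolP; split=> [//|]; exists `|x| => f.
by rewrite mulrC; exact: le_opnorm.
Qed.

Definition canonical_embedding (x : X) : dual (dual X) :=
  BoundedOp (evaluation_bounded_linear x).

Definition reflexive_space : Prop := range canonical_embedding = setT.

End reflexivity.

(* Main.v *)
(* Suppose [T] is orthogonal to [A].  Almost norming points of [T + A/n] have a
   weak cluster point [x] in the unit ball, by reflexivity; compactness of [T]
   and [A] turns weak into norm convergence of the images, and convexity of
   [a |-> |T x + a A x|] shows that [x] lies in [M_T] and that
   [|T x| <= |T x + a A x|] for all [a >= 0].  The same holds for [- A], and up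
   to a sign both points can be taken in [D].  Hence the two closed sets of
   points of [D] where the inequality holds for all [a >= 0], respectively for
   all [a <= 0], are nonempty; by convexity they cover [D], so they meet since
   [D] is connected. *)
Require Import Defs.
From mathcomp Require Import all_boot all_order all_algebra.
From mathcomp Require Import all_classical all_reals all_analysis.
From mathcomp Require Import lra.
Import Order.TTheory GRing.Theory Num.Theory.
Import numFieldNormedType.Exports.
Local Open Scope classical_set_scope.
Local Open Scope ring_scope.

(** * Hahn-Banach theorem for sublinear functionals *)

Section sublinear.
Context {R : realType} {V : lmodType R}.
Implicit Types (p q : V -> R) (x y : V).

(** An inequality for [t > 0] is enough in the second clause: applied to the inverse of [t] it gives
    equality, and it passes easily to infima. *)
Definition sublinear q : Prop :=
  (forall x y, q (x + y) <= q x + q y) /\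
  (forall t x, 0 < t -> q (t *: x) <= t * q x).

Lemma sublinear0 q : sublinear q -> q 0 = 0.
Proof.
case=> qD qZ; have := qD 0 0; have := qZ 2^-1 0.
by rewrite addr0 scaler0 invr_gt0 ltr0n => /(_ isT); lra.
Qed.

Lemma sublinearZ q t x : sublinear q -> 0 <= t -> q (t *: x) = t * q x.
Proof.
move=> ql; have [_ qZ] := ql.
rewrite le_eqVlt => /predU1P[<-|t0]; first by rewrite scale0r mul0r sublinear0.
apply/eqP; rewrite eq_le qZ//= -ler_pdivlMl// -[in leLHS](scalerK (lt0r_neq0 t0) x).
by rewrite qZ// invr_gt0.
Qed.

Lemma sublinearN_ge0 q x : sublinear q -> 0 <= q x + q (- x).
Proof. by move=> ql; rewrite -(sublinear0 _ ql) -(subrr x) ql.1. Qed.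

(** Serves twice: for the ray linearization and for the infimum of a chain in Zorn's lemma. *)
Lemma sublinear_inf (E : V -> set R) :
  (forall x, E x !=set0) -> (forall x, has_lbound (E x)) ->
  (forall x y a b, E x a -> E y b -> exists2 c, E (x + y) c & c <= a + b) ->
  (forall t x a, 0 < t -> E x a -> exists2 c, E (t *: x) c & c <= t * a) ->
  sublinear (fun x => inf (E x)).
Proof.
move=> E0 Elb ED EZ; split=> [x y|t x t0].
  rewrite -lerBlDr; apply: lb_le_inf => // a Exa.
  rewrite lerBlDr -lerBlDl; apply: lb_le_inf => // b Eyb.
  have [c Ec cab] := ED _ _ _ _ Exa Eyb.
  by rewrite lerBlDl (le_trans _ cab)// ge_inf.
rewrite -ler_pdivrMl//; apply: lb_le_inf => // a Exa.
have [c Ec cta] := EZ _ _ _ t0 Exa.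
by rewrite ler_pdivrMl// (le_trans _ cta)// ge_inf.
Qed.

(* The largest sublinear functional below [q] that agrees with [q] at [y] and is
   linear on the line spanned by [y]. *)
Definition ray_linearization q y x : R :=
  inf [set q (x + t *: y) - t * q y | t in [set t | 0 <= t]].

(** Subadditivity at [t *: y = (x + t *: y) + (- x)] bounds every term below by [- q (- x)]. *)
Lemma ray_linearization_lbound q y x : sublinear q ->
  has_lbound [set q (x + t *: y) - t * q y | t in [set t | 0 <= t]].
Proof.
move=> ql; exists (- q (- x)) => _ [t /= t0 <-].
rewrite -(sublinearZ _ _ _ ql t0) lerBrDr addrC lerBlDr.
by have := ql.1 (x + t *: y) (- x); rewrite addrAC subrr add0r.
Qed.

Lemma ray_linearization_le q y x t : sublinear q -> 0 <= t ->
  ray_linearization q y x <= q (x + t *: y) - t * q y.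
Proof.
by move=> ql t0; apply: ge_inf; [exact: ray_linearization_lbound|exists t].
Qed.

Lemma sublinear_ray_linearization q y : sublinear q ->
  sublinear (ray_linearization q y).
Proof.
move=> ql; apply: sublinear_inf => [x|x|x z _ _ [s /= s0 <-] [t /= t0 <-]|
                                    t x _ t0 [s /= s0 <-]].
- by exists (q (x + 0 *: y) - 0 * q y), 0 => /=.
- exact: ray_linearization_lbound.
- exists (q (x + z + (s + t) *: y) - (s + t) * q y).
    by exists (s + t) => //=; rewrite addr_ge0.
  rewrite scalerDl addrACA mulrDl.
  by have := ql.1 (x + s *: y) (z + t *: y); lra.
- exists (q (t *: x + (t * s) *: y) - (t * s) * q y).
    by exists (t * s) => //=; rewrite mulr_ge0// ltW.
  by rewrite -scalerA -scalerDr (sublinearZ _ _ _ ql (ltW t0)) mulrBr mulrA.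
Qed.

(** Zorn's lemma for the reversed pointwise order [rel_ge], whose maximal elements are the minimal
    functionals. *)
Lemma minimal_sublinear p : sublinear p ->
  exists q, [/\ sublinear q, forall x, q x <= p x &
    forall q', sublinear q' -> (forall x, q' x <= q x) -> q' = q].
Proof.
move=> pl.
pose S := {q | sublinear q /\ forall x, q x <= p x}.
pose rel_ge (q1 q2 : S) := `[< forall x, sval q2 x <= sval q1 x >].
have [| | |A Atot|[q [ql qp]] qmin] := @Zorn S rel_ge.
- by move=> q; apply/asboolP => x.
- move=> q1 q2 q3 /asboolP h1 /asboolP h2; apply/asboolP => x.
  exact: le_trans (h2 x) (h1 x).
- move=> [q1 h1] [q2 h2] /asboolP /= h12 /asboolP /= h21; apply: eq_exist => /=.
  by apply/funext => x; apply/eqP; rewrite eq_le h12 h21.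
(* The empty chain is bounded by [p], a nonempty one by its pointwise infimum, finite since
   [q x >= - q (- x) >= - p (- x)]. *)
- have [[q0 Aq0]|A0] := pselect (A !=set0); last first.
    by exists (exist _ p (conj pl (fun x => lexx _))) => q Aq; case: A0; exists q.
  pose E x := [set sval q x | q in A].
  have Elb x : has_lbound (E x).
    exists (- p (- x)) => _ [[q [ql qp]] Aq <-] /=.
    by have := sublinearN_ge0 _ x ql; have := qp (- x); lra.
  have El : sublinear (fun x => inf (E x)).
    apply: sublinear_inf => // [x|x y _ _ [q1 A1 <-] [q2 A2 <-]|t x _ t0 [q Aq <-]].
    + by exists (sval q0 x), q0.
    + have [/asboolP h|/asboolP h] := Atot _ _ A1 A2.
        exists (sval q2 (x + y)); first by exists q2.
        apply: (le_trans ((svalP q2).1.1 x y)).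
        by rewrite lerD2r h.
      exists (sval q1 (x + y)); first by exists q1.
      by apply: (le_trans ((svalP q1).1.1 x y)); rewrite lerD2l h.
    + exists (sval q (t *: x)); first by exists q.
      exact: (svalP q).1.2.
  have Ele (q : S) x : A q -> inf (E x) <= sval q x.
    by move=> Aq; apply: ge_inf => //; exists q.
  have Elp x : inf (E x) <= p x by rewrite (le_trans (Ele _ x Aq0))// (svalP q0).2.
  exists (exist _ (fun x => inf (E x)) (conj El Elp)) => q Aq.
  by apply/asboolP => x; exact: Ele.
exists q; split=> // q' q'l q'q.
have q'p x : q' x <= p x by rewrite (le_trans (q'q x)).
by have /(congr1 sval) := qmin (exist _ q' (conj q'l q'p)) (asboolT q'q).
Qed.

(* A sublinear functional that is minimal for the pointwise order is linear,
   since it equals all its ray linearizations. *)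
Lemma hahn_banach_sublinear p : sublinear p ->
  exists f : V -> R, linear (f : V -> R^o) /\ forall x, f x <= p x.
Proof.
move=> pl; have [q [ql qp qmin]] := minimal_sublinear _ pl.
have qD x y : q (x + y) = q x + q y.
  apply/eqP; rewrite eq_le ql.1/= -lerBrDr.
  have rayE : ray_linearization q y = q.
    apply: qmin => [|z]; first exact: sublinear_ray_linearization.
    have := ray_linearization_le _ y z _ ql (lexx 0).
    by rewrite scale0r addr0 mul0r subr0.
  (* The term [t = 1] of the infimum gives [q x <= q (x + y) - q y], the converse of
     subadditivity. *)
  by have := ray_linearization_le _ y x _ ql ler01; rewrite rayE scale1r mul1r.
have qN x : q (- x) = - q x.
  by apply/eqP; rewrite -addr_eq0 -qD addNr sublinear0.
exists q; split=> // a x y; rewrite qD; congr (_ + _).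
have [a0|/ltW a0] := leP 0 a; first exact: sublinearZ.
by rewrite -[a in LHS]opprK scaleNr qN sublinearZ ?oppr_ge0// mulNr opprK.
Qed.

End sublinear.

(** * Norming functionals and separation of points by the dual *)

Section norming.
Context {R : realType} {X : normedModType R}.

Lemma sublinear_norm : sublinear (fun x : X => `|x|).
Proof.
by split=> [x y|t x t0]; [exact: ler_normD|rewrite normrZ gtr0_norm].
Qed.

(** Dominating by the ray linearization of the norm at [x0] instead of the norm itself forces
    [f (- x0) <= - |x0|], hence equality at [x0]. *)
Lemma exists_norming_functional (x0 : X) :
  exists2 f : dual X, (forall x, `|f x| <= `|x|) & f x0 = `|x0|.
Proof.
have ray_l := sublinear_ray_linearization _ x0 sublinear_norm.
have [f [fl fle]] := hahn_banach_sublinear _ ray_l.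
have fN x : f (- x) = - f x.
  have := fl (- 1) x x; rewrite !scaleN1r !addNr => f0.
  by have := fl (- 1) x 0; rewrite !scaleN1r f0 !addr0.
have f_le x : f x <= `|x|.
  apply: (le_trans (fle x)).
  have := ray_linearization_le _ x0 x _ sublinear_norm (lexx 0).
  by rewrite scale0r addr0 mul0r subr0.
have f_norm x : `|f x| <= `|x|.
  by rewrite ler_norml f_le andbT lerNl -fN (le_trans (f_le _))// normrN.
have fb : f \in @bounded_linear R X R^o.
  by apply/asboolP; split=> //; exists 1 => x; rewrite mul1r f_norm.
exists (BoundedOp fb) => //=; apply/eqP; rewrite eq_le f_le/=.
rewrite -lerN2 -fN (le_trans (fle _))//.
have := ray_linearization_le _ x0 (- x0) _ sublinear_norm ler01.
by rewrite scale1r addNr normr0 mul1r sub0r.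
Qed.

Lemma dual_separates (x y : X) : (forall f : dual X, f x = f y) -> x = y.
Proof.
move=> fxy; have [f _ fE] := exists_norming_functional (x - y).
apply/eqP; rewrite -subr_eq0 -normr_eq0 -fE.
have -> : f (x - y) = f x - f y by exact: linearB.
by rewrite fxy subrr.
Qed.

End norming.

Lemma boundedOp_continuous {R : realType} {X Y : normedModType R}
  (f : boundedOp X Y) : continuous f.
Proof.
apply/linear_bounded_continuous; rewrite /bounded_near; near=> M; near=> z => /=.
apply: (le_trans (le_opnorm f z)); rewrite -[leRHS]mulr1 ler_pM ?opnorm_ge0//.
Unshelve. all: by end_near. Qed.

(** * Weak limits along an ultrafilter, and their images under compact operators *)

Section weak_compactness.
Context {R : realType} {X : normedModType R} {I : Type} (F : set_system I).
Context {FU : UltraFilter F}.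

(** Compactness gives a cluster point, and an ultrafilter converges to each of its cluster
    points. *)
Lemma compact_ultra_cvg {T : topologicalType} (K : set T) (u : I -> T) :
  compact K -> (forall i, K (u i)) -> exists l : T, u @ F --> l.
Proof.
move=> Kco uK; have FK : (u @ F) K.
  by apply: (@filterS _ F _ setT) => [i _|]; [exact: uK|exact: filterT].
have [l [Kl ul]] := Kco _ _ FK.
exists l => V Vl; have [//|FnV] := in_ultra_setVsetC (u @^-1` V) FU.
by have [z [nVz Vz]] := ul (~` V) V FnV Vl.
Qed.

(** Along an ultrafilter the bounded scalars [f (u i)] converge for all [f] at once; the limits form
    an element of the bidual, which reflexivity represents by a point [x]. *)
Lemma reflexive_weak_cvg (u : I -> X) :
  reflexive_space X -> (forall i, `|u i| <= 1) ->
  exists2 x : X, `|x| <= 1 & forall f : dual X, f (u i) @[i --> F] --> f x.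
Proof.
move=> Xrefl u1.
have ufb (f : dual X) i : `|f (u i)| <= `|f|.
  by apply: (le_trans (le_opnorm f (u i))); rewrite ler_piMr// opnorm_ge0.
have ucv (f : dual X) : cvg (f (u i) @[i --> F]).
  apply/cvg_ex/(compact_ultra_cvg _ _ (@segment_compact R (- `|f|) `|f|)) => i.
  by rewrite /= in_itv/= -ler_norml ufb.
pose phi (f : dual X) : R^o := lim (f (u i) @[i --> F]).
have phi_cvg (f : dual X) : f (u i) @[i --> F] --> phi f by exact: ucv.
have phib : phi \in @bounded_linear R (dual X) R^o.
  apply/asboolP; split=> [a f g|].
    apply: cvg_lim => //.
    apply: cvgD; last exact: phi_cvg.
    by apply: cvgZl_tmp; exact: phi_cvg.
  exists 1 => f; rewrite mul1r.
  apply: (closed_cvg _ (@closed_le R `|f|) _ _ (cvg_norm (phi_cvg f))).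
  by apply: nearW => i; exact: ufb.
have [x _ xphi] : range (@canonical_embedding R X) (BoundedOp phib).
  by rewrite Xrefl.
have fx (f : dual X) : f x = phi f by rewrite -[LHS]/(canonical_embedding x f) xphi.
exists x => [|f]; last by rewrite fx.
have [f fn fE] := exists_norming_functional x.
rewrite -fE fx; apply: (closed_cvg _ (@closed_le R 1) _ _ (phi_cvg f)).
by apply: nearW => i /=; rewrite (le_trans (ler_norm _))// (le_trans (fn _)).
Qed.

(** Compactness provides a norm limit [y]; for each functional [g] on [Y], weak convergence tested
    on [g \o T] gives [g y = g (T x)], so [y = T x]. *)
Lemma compact_operator_cvg {Y : normedModType R} (T : boundedOp X Y)
    (u : I -> X) (x : X) :
  compact_operator T -> (forall i, `|u i| <= 1) ->
  (forall f : dual X, f (u i) @[i --> F] --> f x) ->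
  T (u i) @[i --> F] --> T x.
Proof.
rewrite /compact_operator precompactE => Tco u1 ux.
have [y Tuy] : exists y : Y, T (u i) @[i --> F] --> y.
  apply: (compact_ultra_cvg _ _ Tco) => i; apply: subset_closure.
  by exists (u i) => //=; exact: u1.
suff <- : y = T x by [].
apply: dual_separates => g.
have gTb : g \o T \in @bounded_linear R X R^o.
  apply/asboolP; split=> [a v w|]; first by rewrite /= !linearP.
  exists (`|g| * `|T|) => v; rewrite -mulrA.
  apply: (le_trans (le_opnorm g (T v))).
  by rewrite ler_wpM2l ?opnorm_ge0// le_opnorm.
have gc : continuous g by exact: boundedOp_continuous.
have := ux (BoundedOp gTb); apply: cvg_unique => //=.
by apply: continuous_cvg => //; exact: gc.
Qed.

End weak_compactness.

(** * One-sided Birkhoff-James orthogonality *)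

Section one_sided_orthogonality.
Context {R : realType} {V : normedModType R}.
Implicit Types u v : V.

Definition bj_pos u v : Prop := forall a : R, 0 <= a -> `|u| <= `|u + a *: v|.

Lemma birkhoff_jamesE u v :
  birkhoff_james u v <-> bj_pos u v /\ bj_pos u (- v).
Proof.
split=> [uv|[uv uNv] a].
  by split=> a a0; [exact: uv|rewrite scalerN -scaleNr; exact: uv].
have [a0|/ltW a0] := leP 0 a; first exact: uv.
by rewrite -[a]opprK scaleNr -scalerN uNv// oppr_ge0.
Qed.

(** Convexity of the norm between [u] and [u + a *: v], multiplied by [a] to avoid a division. *)
Lemma norm_segment_convex u v (e a : R) : 0 <= e -> e <= a ->
  a * `|u + e *: v| <= (a - e) * `|u| + e * `|u + a *: v|.
Proof.
move=> e0 ea; have a0 : 0 <= a by exact: le_trans ea.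
have normZ (c : R) (w : V) : 0 <= c -> c * `|w| = `|c *: w|.
  by move=> c0; rewrite normrZ ger0_norm.
rewrite !normZ ?subr_ge0// (le_trans _ (ler_normD _ _))//.
by rewrite !scalerDr addrA -scalerDl subrK !scalerA mulrC.
Qed.

(** Otherwise [u] would lie on a segment from [u - b *: v] to [u + a *: v] whose endpoints both have
    smaller norm. *)
Lemma bj_pos_total u v : bj_pos u v \/ bj_pos u (- v).
Proof.
apply: contrapT => /not_orP[/existsNP[a /not_implyP[a0 /negP]]].
rewrite -ltNge => ua /existsNP[b /not_implyP[b0 /negP]].
rewrite -ltNge scalerN => ub.
have := norm_segment_convex (u - b *: v) v _ _ b0 (ler_wpDl a0 (lexx b)).
rewrite subrK addrK scalerDl [a *: v + _]addrC addrA subrK.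
have [a_eq0|an0] := eqVneq a 0; first by rewrite a_eq0 scale0r addr0 ltxx in ua.
have agt0 : 0 < a by rewrite lt_neqAle eq_sym an0.
by nra.
Qed.

End one_sided_orthogonality.

(** * Norm-attaining points that inherit one-sided orthogonality *)

Section norm_attaining.
Context {R : realType} {X Y : normedModType R}.
Implicit Types T A : boundedOp X Y.

Lemma compact_operatorN A : compact_operator A -> compact_operator (- A).
Proof.
rewrite /compact_operator; suff -> : (- A : boundedOp X Y) @` [set x | `|x| <= 1] =
  A @` [set x | `|x| <= 1] by [].
have AN x : A (- x) = (- A : boundedOp X Y) x by rewrite linearN.
apply/seteqP; split=> _ [x /= x1 <-]; exists (- x) => //=; rewrite ?normrN//.
by have := AN (- x); rewrite opprK => ->.
Qed.

Lemma closed_bj_pos T A : closed [set x | bj_pos (T x) (A x)].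
Proof.
have -> : [set x | bj_pos (T x) (A x)] =
  \bigcap_(a in [set a : R | 0 <= a])
    ((fun x => `|T x + a *: A x| - `|T x|) @^-1` [set r | 0 <= r]).
  by apply/seteqP; split=> x Tx a a0; have := Tx a a0; rewrite /= subr_ge0.
apply: closed_bigI => a _; apply: closed_comp; last exact: closed_ge.
move=> x _; apply: cvgB; apply: cvg_norm; last exact: boundedOp_continuous.
apply: cvgD; first exact: boundedOp_continuous.
by apply: cvgZl_tmp; exact: boundedOp_continuous.
Qed.

Lemma exists_almost_norming T (e : R) : 0 < e ->
  exists2 x, `|x| <= 1 & `|T| - e < `|T x|.
Proof.
by move=> /sup_adherent/(_ (opnorm_has_sup T))[_ [x x1 <-] Tx]; exists x.
Qed.

Lemma norm_attaining_bj_pos T A :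
  reflexive_space X -> compact_operator T -> compact_operator A ->
  0 < `|T| -> bj_pos T A ->
  exists2 x, norm_attaining_set T x & bj_pos (T x) (A x).
Proof.
move=> Xrefl Tco Aco T0 TA.
have eps0 n : 0 < @harmonic R n by rewrite invr_gt0 ltr0n.
(* The error is the square of the step [harmonic n], so that it still tends to 0 after the division
   by the step below. *)
have /choice[u uP] : forall n, exists x : X, `|x| <= 1 /\
    `|T| - harmonic n ^+ 2 <= `|T x + harmonic n *: A x|.
  move=> n; have e20 : 0 < @harmonic R n ^+ 2 by rewrite exprn_gt0.
  have [x x1 xP] := exists_almost_norming (T + harmonic n *: A) _ e20.
  exists x; split=> //; apply: le_trans (ltW xP).
  by rewrite lerD2r; exact: TA (ltW (eps0 n)).
have u1 n : `|u n| <= 1 := (uP n).1.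
(* An ultrafilter finer than the filter at infinity replaces the extraction of a subsequence. *)
have [U [UU ooU]] := ultraFilterLemma (eventually_filter).
have [x x1 ux] := reflexive_weak_cvg U u Xrefl u1.
have Tux := compact_operator_cvg U T u x Tco u1 ux.
have Aux := compact_operator_cvg U A u x Aco u1 ux.
have TAx a : 0 < a -> `|T| <= `|T x + a *: A x|.
  move=> a0.
  have TAux : T (u n) + a *: A (u n) @[n --> U] --> T x + a *: A x.
    apply: cvgD; first exact: Tux.
    by apply: (@cvgZl_tmp R Y); exact: Aux.
  (* With [e = harmonic n < a], convexity gives [a (|T| - e^2) <= (a - e) |T| + e |T (u n) + a *: A
     (u n)|]. Cancelling and dividing by [e] leaves the error [a * e]. *)
  have cvg_lhs : (`|T (u n) + a *: A (u n)| + a * harmonic n) @[n --> U] -->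
      (`|T x + a *: A x| + a * 0).
    apply: cvgD; first exact: cvg_norm TAux.
    by apply: cvgMl_tmp; apply: cvg_trans (@cvg_harmonic R) => V; exact: ooU.
  rewrite -[leRHS]addr0 -[X in _ + X](mulr0 a).
  apply: (closed_cvg _ (@closed_ge R `|T|) _ _ cvg_lhs).
  have : \forall n \near \oo, @harmonic R n < a.
    exact: (cvgr_lt 0 (@cvg_harmonic R)).
  move=> /ooU; apply: filterS => n /= /ltW na.
  have := norm_segment_convex (T (u n)) (A (u n)) _ _ (ltW (eps0 n)) na.
  have := (uP n).2; have := eps0 n.
  have : `|T (u n)| <= `|T|.
    by rewrite (le_trans (le_opnorm T (u n)))// ler_piMr// opnorm_ge0.
  set e := harmonic n; set w := `|_ + a *: _|; set z := `|_ + e *: _|.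
  move=> Tn e0 zT zw.
  have az : a * (`|T| - e ^+ 2) <= a * z by rewrite ler_pM2l.
  have aT : (a - e) * `|T (u n)| <= (a - e) * `|T|.
    by rewrite ler_wpM2l// subr_ge0.
  change (`|T| <= w + a * e); rewrite -(ler_pM2l e0); lra.
have TxT : `|T x| = `|T|.
  apply/eqP; rewrite eq_le; apply/andP; split.
    by rewrite (le_trans (le_opnorm T x))// ler_piMr// opnorm_ge0.
  (* [TAx] is used for small [a]: this choice makes [a * |A x|] at most [e], the added 1 covering
     the case [A x = 0]. *)
  apply/ler_addgt0Pr => e e0; pose a := e / (`|A x| + 1).
  have A1 : 0 < `|A x| + 1 by rewrite ltr_wpDl.
  have a0 : 0 < a by rewrite divr_gt0.
  rewrite (le_trans (TAx _ a0))// (le_trans (ler_normD _ _))// lerD2l.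
  by rewrite normrZ gtr0_norm// mulrAC ler_pdivrMr// ler_pM2l// lerDl.
exists x; last first.
  move=> a; rewrite le_eqVlt => /predU1P[<-|a0]; first by rewrite scale0r addr0.
  by rewrite TxT TAx.
(* Since [|T| = |T x| <= |T| |x|] and [|T| > 0], the weak limit [x] has norm at least 1. *)
split=> //; apply/eqP; rewrite eq_le x1/= -(ler_pM2l T0) mulr1 -[leLHS]TxT.
exact: le_opnorm.
Qed.

End norm_attaining.

Theorem theorem2p1 (R : realType) (X : completeNormedModType R)
    (Y : normedModType R) (T : boundedOp X Y) (D : set X) :
  reflexive_space X ->
  compact_operator T ->
  D !=set0 -> D `<=` unit_sphere X -> compact D -> connected D ->
  norm_attaining_set T = D `|` (-%R @` D) ->
  forall A : boundedOp X Y, compact_operator A ->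
    (birkhoff_james T A <->
     exists2 x : X, norm_attaining_set T x & birkhoff_james (T x) (A x)).
Proof.
move=> Xrefl Tco [d Dd] DS _ Dconn MT A Aco; split; last first.
  (* The easy direction: [|T| = |T x| <= |T x + a *: A x| <= |T + a *: A|]. *)
  move=> [x [x1 TxT] TAx] a; rewrite -TxT (le_trans (TAx a))//.
  by rewrite -[leRHS]mulr1 -[in leRHS]x1; exact: (le_opnorm (T + a *: A)).
have DM x : D x -> norm_attaining_set T x by rewrite MT; left.
move=> TA.
have [T0|Tn0] := eqVneq `|T| 0.
  exists d => [|a]; first exact: DM.
  by rewrite (DM _ Dd).2 T0.
have Tgt0 : 0 < `|T| by rewrite lt_neqAle eq_sym Tn0 normr_ge0.
have half B : compact_operator B -> bj_pos T B ->
    exists2 x, D x & bj_pos (T x) (B x).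
  move=> Bco TB; have [x] := norm_attaining_bj_pos _ _ Xrefl Tco Bco Tgt0 TB.
  rewrite MT => -[Dx|[y Dy <-]] xP; first by exists x.
  (* The inequality at [- y] is the one at [y], because both sides are norms of opposite vectors. *)
  exists y => // a /xP; rewrite !linearN/= normrN.
  by rewrite -opprD normrN.
have [TApos TAneg] := (birkhoff_jamesE T A).1 TA.
have [x Dx xP] := half _ Aco TApos.
have [y Dy yP] := half _ (compact_operatorN _ Aco) TAneg.
apply: contrapT => nTA.
have excl z : D z -> bj_pos (T z) (A z) -> ~ bj_pos (T z) (- A z).
  move=> Dz zpos zneg; apply: nTA; exists z; first exact: DM.
  exact/birkhoff_jamesE.
(* If no point of [D] satisfies both conditions, the positive part of [D] is closed and is also the
   complement in [D] of a closed set. It contains [x], so it is all of [D], which contradicts [yP]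
   at [y]. *)
have DE : D `&` [set z | bj_pos (T z) (A z)] = D.
  apply: Dconn; first by exists x.
  - exists (~` [set z | bj_pos (T z) ((- A : boundedOp X Y) z)]).
      exact/closed_openC/closed_bj_pos.
    apply/seteqP; split=> z [Dz zP]; split=> //; first exact: excl.
    by have [//|] := bj_pos_total (T z) (A z).
  - by exists [set z | bj_pos (T z) (A z)] => //; exact: closed_bj_pos.
by have : D y by []; rewrite -DE => -[_ /excl]; exact.
Qed.
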